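(* Let $d,k\ge1$, let $\mu$ be a probability measure on $\mathbb{R}^d$ that is absolutely continuous with respect to Lebesgue measure, and let $\nu=\sum_{j=1}^kb_j\delta_{\mathbf{u}_j}$ with $\mathbf{u}_1,\dots,\mathbf{u}_k\in\mathbb{R}^d$ and $\mathbf{b}=(b_1,\dots,b_k)$ satisfying $b_j\ge0$ and $\sum_{j=1}^kb_j=1$. Let $\mathbf{g}^*\in\mathbb{R}^k$ be an optimal dual potential for the semi-discrete optimal transport problem between $\mu$ and $\nu$ with the squared $L_2$ cost, i.e. a maximizer of $$\sup_{\mathbf{g}\in\mathbb{R}^k}\Big\{\int_{\mathbb{R}^d}g^c(\mathbf{z})\,\mathrm{d}\mu(\mathbf{z})+\sum_{j=1}^kb_jg_j\Big\},\qquad g^c(\mathbf{z})=\min_{1\le j\le k}\big\{\|\mathbf{z}-\mathbf{u}_j\|_2^2-g_j\big\}.$$ If $T_{\mathbf{g}^*}:\mathbb{R}^d\to\mathbb{R}^d$ is a measurable map such that $$T_{\mathbf{g}^*}(\mathbf{z})\in\{\mathbf{u}_j:\ j\in\{1,\dots,k\},\ \mathbf{z}\in\mathbb{L}_{\mathbf{g}^*}(\mathbf{u}_j)\}\qquad\text{for every }\mathbf{z}\in\mathbb{R}^d,$$ then $T_{\mathbf{g}^*}$ has a cyclically monotone graph, i.e. the set $\{(\mathbf{z},T_{\mathbf{g}^*}(\mathbf{z})):\mathbf{z}\in\mathbb{R}^d\}$ is cyclically monotone.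
   Context: For $\mathbf{g}\in\mathbb{R}^k$ the Laguerre cell associated with $\mathbf{u}_j$ is $$\mathbb{L}_{\mathbf{g}}(\mathbf{u}_j)=\{\mathbf{z}\in\mathbb{R}^d:\ \|\mathbf{z}-\mathbf{u}_j\|_2^2-g_j\le\|\mathbf{z}-\mathbf{u}_{j'}\|_2^2-g_{j'}\ \text{ for all } j'\ne j\}.$$ A set $\Gamma\subseteq\mathbb{R}^d\times\mathbb{R}^d$ is cyclically monotone if for every $m\in\mathbb{N}$ and every family $(\mathbf{x}_1,\mathbf{y}_1),\dots,(\mathbf{x}_m,\mathbf{y}_m)\in\Gamma$ (with the convention $\mathbf{y}_{m+1}=\mathbf{y}_1$) one has $$-\sum_{i=1}^m\langle\mathbf{x}_i,\mathbf{y}_i\rangle\le-\sum_{i=1}^m\langle\mathbf{x}_i,\mathbf{y}_{i+1}\rangle.$$ *)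

(* Defs.v *)
From HB Require Import structures.
From mathcomp Require Import all_boot all_order all_algebra.
From mathcomp Require Import all_classical all_reals all_analysis.
From mathcomp Require Import measurable_realfun.

Set Implicit Arguments.
Unset Strict Implicit.
Unset Printing Implicit Defensive.

Import Order.TTheory GRing.Theory Num.Theory.
Import numFieldNormedType.Exports.

Local Open Scope classical_set_scope.
Local Open Scope ring_scope.

(* Row vectors carry the sigma-algebra generated by the coordinate maps, as
   n.-tuple T does in the library; it is the Borel sigma-algebra when T is the
   real line, see [measurable_rV_borel]. *)
Definition measure_rV_display : measure_display -> measure_display.
Proof. exact. Qed.

Section measurable_rV.
Context {d} {T : measurableType d}.
Variable n : nat.

Let coors : 'I_n -> 'rV[T]_n -> T := fun i x => x ord0 i.

Let rV_set0 : g_sigma_preimage coors set0.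
Proof. exact: sigma_algebra0. Qed.

Let rV_setC A : g_sigma_preimage coors A -> g_sigma_preimage coors (~` A).
Proof. exact: sigma_algebraC. Qed.

Let rV_bigcup (F : (set 'rV[T]_n)^nat) :
  (forall i, g_sigma_preimage coors (F i)) ->
  g_sigma_preimage coors (\bigcup_i (F i)).
Proof. exact: sigma_algebra_bigcup. Qed.

HB.instance Definition _ := @isMeasurable.Build (measure_rV_display d)
  'rV[T]_n (g_sigma_preimage coors) rV_set0 rV_setC rV_bigcup.

End measurable_rV.

Lemma measurable_coord d (T : measurableType d) n (i : 'I_n) :
  measurable_fun [set: 'rV[T]_n] (fun x : 'rV[T]_n => x ord0 i).
Proof.
move=> _ Y mY; rewrite setTI; apply: sub_sigma_algebra => /=.
rewrite -bigcup_seq/=; exists i => /=; first by rewrite mem_index_enum.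
by exists Y => //; rewrite setTI.
Qed.

Lemma measurable_fun_rVP d1 d2 (T1 : measurableType d1)
    (T2 : measurableType d2) n (f : T1 -> 'rV[T2]_n) :
  measurable_fun [set: T1] f <->
  forall i, measurable_fun [set: T1] (fun x => f x ord0 i).
Proof.
split=> [mf i|mf _ A mA].
  exact: (measurableT_comp (measurable_coord i) mf).
rewrite setTI; move: A mA.
have sa : sigma_algebra [set: 'rV[T2]_n] [set A | measurable (f @^-1` A)].
  split => /=.
  - by rewrite preimage_set0.
  - by move=> A mA; rewrite setTD preimage_setC; exact: measurableC.
  - by move=> F mF; rewrite preimage_bigcup; exact: bigcup_measurable.
apply: smallest_sub => //.
move=> A; rewrite -bigcup_seq/= => -[i _ [B mB <-]].
rewrite setTI /= -[X in measurable X]setTI.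
exact: mf.
Qed.

Lemma measurable_rV_borel (R : realType) n :
  @measurable _ 'rV[R]_n = <<s @open 'rV[R]_n >>.
Proof.
apply/seteqP; split.
- apply: smallest_sub; first exact: smallest_sigma_algebra.
  move=> A; rewrite -bigcup_seq/= => -[i _ [B mB <-]]; rewrite setTI.
  have {}mB : (@RGenOpens.G R).-sigma.-measurable B.
    by rewrite -RGenOpens.measurableE.
  suff: (@RGenOpens.G R).-sigma.-measurable `<=`
      [set B | <<s @open 'rV[R]_n >> ((fun x : 'rV[R]_n => x ord0 i) @^-1` B)].
    exact.
  apply: smallest_sub => [|_ [a [b ->]]] /=.
    split => /=.
    + by rewrite preimage_set0; exact: sigma_algebra0.
    + by move=> C mC; rewrite setTD preimage_setC; exact: sigma_algebraC.
    + by move=> F mF; rewrite preimage_bigcup; exact: sigma_algebra_bigcup.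
  apply: sub_sigma_algebra => /=; apply: open_comp; last exact: interval_open.
  by move=> ? _; exact: coord_continuous.
- apply: smallest_sub; first exact: sigma_algebra_measurable.
  move=> U oU.
  pose box (r : {ffun 'I_n -> rat * rat}) : set 'rV[R]_n :=
    \big[setI/setT]_(i < n)
      ((fun x : 'rV[R]_n => x ord0 i) @^-1` `]ratr (r i).1, ratr (r i).2[%classic).
  have boxE r : box r =
      [set x | forall i, x ord0 i \in `]ratr (r i).1, ratr (r i).2[].
    rewrite /box -bigcap_seq; apply/seteqP; split => x /= rx i => [|_];
      last exact: rx.
    by apply: rx; rewrite /= mem_index_enum.
  have -> : U = \bigcup_r (if `[< box r `<=` U >] then box r else set0).
    apply/seteqP; split => [x Ux|x [r _]]; last first.
      by case: ifPn => // /asboolP; exact.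
    have [P Px PU] : nbhs x U by exact: open_nbhs_nbhs.
    have /choice[r rP] : forall i, exists r : rat * rat,
        (x ord0 i \in `]ratr r.1, ratr r.2[) /\
        `]ratr r.1, ratr r.2[%classic `<=` P ord0 i.
      move=> i; have /nbhs_ballP[e /= e0 eP] := Px ord0 i.
      have /rat_in_itvoo[p] : x ord0 i - e < x ord0 i by rewrite gtrBl.
      rewrite in_itv/= => /andP[p1 p2].
      have /rat_in_itvoo[q] : x ord0 i < x ord0 i + e by rewrite ltrDl.
      rewrite in_itv/= => /andP[q1 q2].
      exists (p, q); rewrite in_itv/= p2 q1; split => // y /=.
      rewrite in_itv/= => /andP[py yq]; apply: eP.
      by rewrite /ball/= ltr_distlC (lt_trans p1)//= (lt_trans yq).
    have bx : box [ffun i => r i] x.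
      by rewrite boxE => i; rewrite ffunE; have [] := rP i.
    exists [ffun i => r i] => //; rewrite asboolT//.
    rewrite boxE => y /= yr; apply: PU => i j; rewrite (ord1 i).
    by have [_] := rP j; apply; have := yr j; rewrite ffunE.
  apply: countable_bigcupT_measurable => [|r].
    exact: countableP.
  case: ifPn => // _; apply: bigsetI_measurable => i _.
  by rewrite -[X in measurable X]setTI; exact: measurable_coord.
Qed.

Section lebesgue_rV.
Context {R : realType}.
Local Open Scope ereal_scope.

Definition rV_cons n (p : measurableTypeR R * 'rV[R]_n) : 'rV[R]_n.+1 :=
  \row_j oapp (fun i => p.2 ord0 i) p.1 (unlift ord0 j).

Definition rV_uncons n (x : 'rV[R]_n.+1) : measurableTypeR R * 'rV[R]_n :=
  (x ord0 ord0, \row_i x ord0 (lift ord0 i)).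

Lemma rV_consK n : cancel (@rV_cons n) (@rV_uncons n).
Proof.
move=> [a x]; rewrite /rV_uncons /rV_cons mxE unlift_none/=; congr pair.
by apply/rowP => i; rewrite !mxE liftK.
Qed.

Lemma measurable_rV_cons n : measurable_fun setT (@rV_cons n).
Proof.
apply/measurable_fun_rVP => j.
under eq_fun do rewrite mxE.
case: unliftP => [i _|_] /=; last exact: measurable_fst.
exact: (measurableT_comp (measurable_coord i) measurable_snd).
Qed.

Lemma measurable_rV_uncons n : measurable_fun setT (@rV_uncons n).
Proof.
apply/measurable_fun_pairP; split.
  exact: measurable_coord.
apply/measurable_fun_rVP => i /=.
under eq_fun do rewrite mxE.
exact: measurable_coord.
Qed.

Lemma sigma_finite_product d1 d2 (T1 : measurableType d1)
    (T2 : measurableType d2) (m1 : {sigma_finite_measure set T1 -> \bar R})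
    (m2 : {sigma_finite_measure set T2 -> \bar R}) :
  sigma_finite setT (m1 \x m2).
Proof.
have /sigma_finiteP[F [TF ndF Foo]] := sigma_finiteT m1.
have /sigma_finiteP[G [TG ndG Goo]] := sigma_finiteT m2.
exists (fun n => F n `*` G n).
  rewrite -setXTT TF TG predeqE => -[x y]; split.
    move=> [/= [n _ Fnx] [k _ Gky]]; exists (maxn n k) => //; split.
    - by move: x Fnx; exact/subsetPset/ndF/leq_maxl.
    - by move: y Gky; exact/subsetPset/ndG/leq_maxr.
  by move=> [n _ []/= ? ?]; split; exists n.
move=> k; have [? ?] := Foo k; have [? ?] := Goo k.
split; first exact: measurableX.
by rewrite product_measure1E// lte_mul_pinfty// ge0_fin_numE.
Qed.

Section step.
Variables (n : nat) (m : {sigma_finite_measure set 'rV[R]_n -> \bar R}).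

Definition lebesgue_rV_step : set 'rV[R]_n.+1 -> \bar R :=
  pushforward (@lebesgue_measure R \x m) (@rV_cons n).

Let measurable_preimage A : measurable A -> measurable (@rV_cons n @^-1` A).
Proof.
by move=> mA; rewrite -[X in measurable X]setTI; exact: measurable_rV_cons.
Qed.

Let step0 : lebesgue_rV_step set0 = 0.
Proof. by rewrite /lebesgue_rV_step /pushforward preimage_set0 measure0. Qed.

Let step_ge0 A : 0 <= lebesgue_rV_step A.
Proof. by rewrite /lebesgue_rV_step /pushforward measure_ge0. Qed.

Let step_sigma_additive : semi_sigma_additive lebesgue_rV_step.
Proof.
move=> F mF tF mUF; rewrite /lebesgue_rV_step /pushforward preimage_bigcup.
apply: measure_semi_sigma_additive.
- by move=> i; exact: measurable_preimage.
- apply/trivIsetP => /= i j _ _ ij; rewrite -preimage_setI.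
  by move/trivIsetP : tF => /(_ _ _ _ _ ij) ->//; rewrite preimage_set0.
- by rewrite -preimage_bigcup; exact: measurable_preimage.
Qed.

HB.instance Definition _ := isMeasure.Build _ _ _ lebesgue_rV_step
  step0 step_ge0 step_sigma_additive.

Let sigma_finite_step : sigma_finite setT lebesgue_rV_step.
Proof.
have [F UF mF] := sigma_finite_product (@lebesgue_measure R) m.
exists (fun k => @rV_uncons n @^-1` F k).
  by rewrite -preimage_bigcup -UF preimage_setT.
move=> k; have [mFk Fk] := mF k; split.
  by rewrite -[X in measurable X]setTI; exact: measurable_rV_uncons.
rewrite /lebesgue_rV_step /pushforward -comp_preimage.
rewrite (_ : _ @^-1` F k = F k)//.
by rewrite (_ : _ \o _ = id)//; apply/funext => x /=; rewrite rV_consK.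
Qed.

HB.instance Definition _ := Measure_isSigmaFinite.Build _ _ _ lebesgue_rV_step
  sigma_finite_step.

End step.

(* The n-fold product of the one-dimensional Lebesgue measure, transported from
   R * 'rV[R]_n to 'rV[R]_n.+1 at each step; [lebesgue_rV_box] computes it on
   boxes. *)
Fixpoint lebesgue_rV n : {sigma_finite_measure set 'rV[R]_n -> \bar R} :=
  if n is n'.+1 then lebesgue_rV_step (lebesgue_rV n') else \d_(0%R : 'rV[R]_0).

Lemma lebesgue_rV_box n (A : 'I_n -> set R) :
  (forall i, measurable (A i)) ->
  lebesgue_rV n [set x | forall i, A i (x ord0 i)] =
  \prod_(i < n) lebesgue_measure (A i).
Proof.
elim: n A => [|n ih] A mA.
  by rewrite big_ord0 /= diracE mem_set// => -[].
have mbox k (B : 'I_k -> set R) :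
    (forall i, measurable (B i)) ->
    measurable [set x : 'rV[R]_k | forall i, B i (x ord0 i)].
  move=> mB; rewrite (_ : [set x | _] =
      \big[setI/setT]_(i < k) ((fun x : 'rV[R]_k => x ord0 i) @^-1` B i)).
    apply: bigsetI_measurable => i _; rewrite -[X in measurable X]setTI.
    by apply: (@measurable_coord _ R k i) => //; exact: mB.
  rewrite -bigcap_seq; apply/seteqP; split => x /= Bx i => [_|].
    exact: Bx.
  by apply: Bx; rewrite /= mem_index_enum.
rewrite big_ord_recl -ih// -(@product_measure1E _ _ _ _ _ _ (lebesgue_rV n))//.
- rewrite /= /lebesgue_rV_step /pushforward; congr (_ _).
  apply/seteqP; split => -[a x] /=.
    move=> Aax; split => [|i].
      by have := Aax ord0; rewrite mxE unlift_none.
    by have := Aax (lift ord0 i); rewrite mxE liftK.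
  by move=> [Aa Ax] i; rewrite mxE; case: unliftP => [j ->|->]/=.
- exact: mA.
- exact: (mbox _ (fun i => A (lift ord0 i))).
Qed.

End lebesgue_rV.

Section semi_discrete_ot.
Context {R : realType}.

Definition dotp d (x y : 'rV[R]_d) : R := \sum_(i < d) x ord0 i * y ord0 i.

(* The library's norm `|x| on 'rV[R]_d is the sup norm. *)
Definition l2norm d (x : 'rV[R]_d) : R :=
  Num.sqrt (\sum_(i < d) x ord0 i ^+ 2).

(* The cell is attached to the index j, the points u j need not be distinct. *)
Definition laguerre_cell d k (u : 'I_k -> 'rV[R]_d) (g : 'rV[R]_k) (j : 'I_k)
    : set 'rV[R]_d :=
  [set z | forall j', j' != j ->
    l2norm (z - u j) ^+ 2 - g ord0 j <= l2norm (z - u j') ^+ 2 - g ord0 j'].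

(* Taken in \bar R, so that +oo is neutral for min. *)
Definition c_transform d k (u : 'I_k -> 'rV[R]_d) (g : 'rV[R]_k)
    (z : 'rV[R]_d) : \bar R :=
  \big[Order.min/+oo%E]_(j < k) (l2norm (z - u j) ^+ 2 - g ord0 j)%:E.

(* c_transform is bounded below, so the integral is well defined in
   ]-oo, +oo]; it is +oo when mu has no finite second moment. *)
Definition dual_objective d k (mu : {measure set 'rV[R]_d -> \bar R})
    (u : 'I_k -> 'rV[R]_d) (b g : 'rV[R]_k) : \bar R :=
  (\int[mu]_z c_transform u g z + (\sum_(j < k) b ord0 j * g ord0 j)%:E)%E.

Definition optimal_dual_potential d k
    (mu : {measure set 'rV[R]_d -> \bar R}) (u : 'I_k -> 'rV[R]_d)
    (b gstar : 'rV[R]_k) : Prop :=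
  forall g : 'rV[R]_k,
    (dual_objective mu u b g <= dual_objective mu u b gstar)%E.

(* ordS is the cyclic successor on 'I_m. *)
Definition cyclically_monotone d (G : set ('rV[R]_d * 'rV[R]_d)) : Prop :=
  forall (m : nat) (p : 'I_m -> 'rV[R]_d * 'rV[R]_d),
    (forall i, G (p i)) ->
    - \sum_(i < m) dotp (p i).1 (p i).2 <=
    - \sum_(i < m) dotp (p i).1 (p (ordS i)).2.

End semi_discrete_ot.

(* Main.v *)
(* Expanding the squares, z lies in the Laguerre cell of j exactly when j
   maximises the affine functions 2 <z, u_j> - (|u_j|^2 - g_j). Summing these
   inequalities along a cycle of points, the weights |u_j|^2 - g_j telescope. *)
Require Import Defs.
From mathcomp Require Import all_boot all_order all_algebra.
From mathcomp Require Import all_classical all_reals all_analysis.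
From mathcomp Require Import ring lra.

Import Order.TTheory GRing.Theory Num.Theory.

Local Open Scope classical_set_scope.
Local Open Scope ring_scope.

Lemma sqr_l2normB (R : realType) d (x y : 'rV[R]_d) :
  l2norm (x - y) ^+ 2 = dotp x x - 2 * dotp x y + dotp y y.
Proof.
rewrite /l2norm sqr_sqrtr; last by apply: sumr_ge0 => i _; exact: sqr_ge0.
rewrite /dotp mulr_sumr -sumrB -big_split /=; apply: eq_bigr => i _.
by rewrite !mxE; ring.
Qed.

(** The term [dotp z z] occurs on both sides of the cell inequality and cancels. The case [j' = j],
    left out of the cell, is an equality; it arises when consecutive points of a cycle share an
    index. *)
Lemma laguerre_cell_le_dotp (R : realType) d k (u : 'I_k -> 'rV[R]_d)
    (g : 'rV[R]_k) (j j' : 'I_k) (z : 'rV[R]_d) :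
  laguerre_cell u g j z ->
  2 * dotp z (u j') - (dotp (u j') (u j') - g ord0 j') <=
  2 * dotp z (u j) - (dotp (u j) (u j) - g ord0 j).
Proof.
have [->//|j'j /(_ _ j'j)] := eqVneq j' j.
by rewrite !sqr_l2normB; lra.
Qed.

(** This set contains the graph of every selection [T] of the cells, and cyclic monotonicity passes
    to subsets. *)
Lemma cyclically_monotone_laguerre (R : realType) d k (u : 'I_k -> 'rV[R]_d)
    (g : 'rV[R]_k) :
  cyclically_monotone
    [set p | exists2 j, laguerre_cell u g j p.1 & u j = p.2].
Proof.
move=> m p pG.
(* Indices are chosen rather than points: if [u] repeats a value, the weight still depends on the
   index through [g]. *)
have /choice[j jP] : forall i, exists j,
    laguerre_cell u g j (p i).1 /\ u j = (p i).2.
  by move=> i; have [j] := pG i; exists j.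
have uj i : u (j i) = (p i).2 by case: (jP i).
pose c i : R := dotp (u (j i)) (u (j i)) - g ord0 (j i).
have le_cycle : \sum_(i < m) (2 * dotp (p i).1 (p (ordS i)).2 - c (ordS i)) <=
                \sum_(i < m) (2 * dotp (p i).1 (p i).2 - c i).
  apply: ler_sum => i _; rewrite -!uj.
  by apply: laguerre_cell_le_dotp; case: (jP i).
(* The cyclic successor permutes ['I_m]. *)
have c_cycle : \sum_(i < m) c i = \sum_(i < m) c (ordS i).
  exact: (reindex_inj (@ordS_inj m)).
(* Generalising [c] hides its body, so its sums stay whole and are atoms for [lra]. *)
by move: c le_cycle c_cycle => c; rewrite !sumrB -!mulr_sumr; lra.
Qed.

Theorem theorem3 (R : realType) (d k : nat) (d_gt0 : (0 < d)%N)
    (k_gt0 : (0 < k)%N)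
    (mu : probability 'rV[R]_d R) (mu_ac : mu `<< lebesgue_rV d)
    (u : 'I_k -> 'rV[R]_d) (b : 'rV[R]_k)
    (b_ge0 : forall j, 0 <= b ord0 j) (b_sum1 : \sum_(j < k) b ord0 j = 1)
    (nu : probability 'rV[R]_d R)
    (nuE : forall A : set 'rV[R]_d, measurable A ->
      nu A = (\sum_(j < k) (b ord0 j)%:E * \d_(u j) A)%E)
    (gstar : 'rV[R]_k)
    (gstar_opt : optimal_dual_potential mu u b gstar)
    (T : 'rV[R]_d -> 'rV[R]_d) (mT : measurable_fun setT T)
    (T_laguerre : forall z : 'rV[R]_d,
      [set u j | j in [set j | laguerre_cell u gstar j z]] (T z)) :
  cyclically_monotone [set (z, T z) | z in [set: 'rV[R]_d]].
Proof.
move=> m p pT; apply: (@cyclically_monotone_laguerre _ _ _ u gstar) => i.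
by have [z _ <-] := pT i; have [j zj ujT] := T_laguerre z; exists j.
Qed.
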